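(* Let $\mathbb K$ be an algebraically closed field of characteristic zero. Let $f \in \mathbb K[x,y]$ and let $p \in \mathbb K[x,y]$ be a (nonconstant) generative closed polynomial for $f$, with $f = \theta(p)$ for a polynomial $\theta(t) \in \mathbb K[t]$, $\deg \theta \geq 1$. Let $T \in W_2(\mathbb K)$. Then $T$ commutes with $D_f$ (that is, $[T, D_f] = 0$) if and only if there exists a polynomial $\psi(t) \in \mathbb K[t]$ such that $T(p) = \psi(p)$ and $$\theta''(p)\,\psi(p) = \theta'(p)\,\bigl(\operatorname{div} T - \psi'(p)\bigr).$$
   Context: $W_2(\mathbb K)$ is the Lie algebra of all $\mathbb K$-derivations of $\mathbb K[x,y]$ with bracket $[D_1,D_2] = D_1D_2 - D_2D_1$; each $T \in W_2(\mathbb K)$ is uniquely $T = P\,\partial_x + Q\,\partial_y$ with $P,Q \in \mathbb K[x,y]$, and $\operatorname{div} T = \partial P/\partial x + \partial Q/\partial y$. For $f \in \mathbb K[x,y]$ the Jacobian derivation $D_f \in W_2(\mathbb K)$ is defined by $D_f(h) = \det J(f,h) = f'_x h'_y - f'_y h'_x$ for all $h\in\mathbb K[x,y]$, i.e. $D_f = -f'_y\,\partial_x + f'_x\,\partial_y$. A nonconstant polynomial $p \in \mathbb K[x,y]$ is called closed if the subalgebra $\mathbb K[p]$ is integrally closed in $\mathbb K[x,y]$. A generative closed polynomial for $f$ is a closed polynomial $p$ such that $f = \varphi(p)$ for some $\varphi(t) \in \mathbb K[t]$. Primes on $\theta, \psi$ denote derivatives with respect to $t$. *)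

(* Defs.v *)
From HB Require Import structures.
From mathcomp Require Export all_boot all_order all_algebra.
From mathcomp Require Export mpoly.
From mathcomp Require Import ring.

Set Implicit Arguments.
Unset Strict Implicit.
Unset Printing Implicit Defensive.

Import GRing.Theory.
Local Open Scope ring_scope.

(* K[x,y] is {mpoly K[2]}, with x of index 0 and y of index 1. *)
Definition ix : 'I_2 := ord0.
Definition iy : 'I_2 := ord_max.

Record W2 (K : fieldType) := MkW2 {
  W2_map :> {linear {mpoly K[2]} -> {mpoly K[2]}};
  W2_leibniz : forall g h : {mpoly K[2]},
    W2_map (g * h) = W2_map g * h + g * W2_map h
}.

Section Derivations.
Variable K : fieldType.
Implicit Types (f g h p : {mpoly K[2]}) (T : W2 K).

Definition bracket_map T1 T2 : {linear {mpoly K[2]} -> {mpoly K[2]}} :=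
  (T1 \o T2) \- (T2 \o T1).

Fact bracket_leibniz T1 T2 g h :
  bracket_map T1 T2 (g * h) = bracket_map T1 T2 g * h + g * bracket_map T1 T2 h.
Proof. by rewrite /= !W2_leibniz !linearD /= !W2_leibniz; ring. Qed.

Definition bracket T1 T2 : W2 K := MkW2 (@bracket_leibniz T1 T2).

Definition jacobian_fun f h : {mpoly K[2]} :=
  f^`M(ix) * h^`M(iy) - f^`M(iy) * h^`M(ix).

Fact jacobian_is_linear f : linear (jacobian_fun f).
Proof.
move=> c g h; rewrite /jacobian_fun !mderivD !mderivZ !mulrDr scalerBr.
by rewrite -!scalerAr; ring.
Qed.

HB.instance Definition _ f :=
  GRing.isLinear.Build K {mpoly K[2]} {mpoly K[2]} _
    (jacobian_fun f) (jacobian_is_linear f).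

Fact jacobian_leibniz f g h :
  jacobian_fun f (g * h) = jacobian_fun f g * h + g * jacobian_fun f h.
Proof. by rewrite /jacobian_fun !mderivM; ring. Qed.

Definition jacobian_der f : W2 K := MkW2 (@jacobian_leibniz f).

(* The components of T = P d/dx + Q d/dy are P = T(x) and Q = T(y); see W2E. *)
Definition divergence T : {mpoly K[2]} := (T 'X_ix)^`M(ix) + (T 'X_iy)^`M(iy).

Lemma W2_1 T : T 1 = 0.
Proof.
have := W2_leibniz T 1 1; rewrite !mulr1 mul1r => /eqP.
by rewrite -subr_eq0 opprD addrA subrr sub0r oppr_eq0 => /eqP.
Qed.

Lemma W2E T h : T h = T 'X_ix * h^`M(ix) + T 'X_iy * h^`M(iy).
Proof.
pose P g := T g = T 'X_ix * g^`M(ix) + T 'X_iy * g^`M(iy).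
have P1 : P 1 by rewrite /P W2_1 -mpolyC1 !mderivC !mulr0 addr0.
have PM g k : P g -> P k -> P (g * k).
  by rewrite /P W2_leibniz !mderivM => -> ->; ring.
have PX i : P 'X_i.
  have mX (j k : 'I_2) : 'X_j^`M(k) = (j == k)%:R :> {mpoly K[2]}.
    rewrite mderivX mnm1E; case: eqP => [->|_]; last by rewrite scale0r.
    by rewrite scale1r -{1}[U_(k)%MM]add0m addmK mpolyX0.
  rewrite /P !mX; have [->|->] : i = ix \/ i = iy.
  - by case: i => [[|[|//]]] lti; [left | right]; apply: val_inj.
  - by rewrite mulr1 mulr0 addr0.
  - by rewrite mulr1 mulr0 add0r.
have Pm m : P 'X_[m].
  rewrite mpolyXE_id; apply: (big_ind P) => // i _.
  by elim: (m i) => [|k IHk]; rewrite ?expr0 // exprS; apply: PM.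
rewrite -/(P h); elim/mpolyind: h => [|c m g _ _ IHg].
  by rewrite /P !linear0 !mulr0 addr0.
by rewrite /P !linearP /= (Pm m) IHg -!mul_mpolyC; ring.
Qed.

(* The structure morphism horner_alg p : K[t] -> K[x,y] maps phi to phi(p), so
   that K[p] is its image and integralOver (horner_alg p) is integrality over
   K[p]. *)
Definition closed_poly p : Prop :=
  (forall c : K, p <> c%:MP) /\
  (forall g, integralOver (horner_alg p) g ->
     exists phi : {poly K}, g = horner_alg p phi).

Definition generative_closed f p : Prop :=
  closed_poly p /\ exists phi : {poly K}, f = horner_alg p phi.

End Derivations.

(* Main.v *)
Require Import Defs.
From mathcomp Require Import ring zify.

Set Implicit Arguments.
Unset Strict Implicit.

Import Order.TTheory GRing.Theory.
Local Open Scope ring_scope.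

(** Everything rests on the identity
      [T, D_f](h) = J(T f, h) - div(T) J(f, h),
    valid for every derivation T (bracket_jacobian).  If T(p) = psi(p), the
    chain rule turns its right-hand side into
      (theta''(p) psi(p) - theta'(p) (div T - psi'(p))) J(p, h)
    and J(p, h) is nonzero for some h because p is not constant.  So, once T(p) is known to lie in K[p], the
    vanishing of the bracket is equivalent to the differential equation.

    It remains to see that T(p) lies in K[p] when T commutes with D_f.  Taking
    h = f gives J(T f, f) = 0, and since f = theta(p) with theta'(p) nonzero,
    this is J(p, T p) = 0.  The claim is thus that the kernel of D_p is K[p]
    when p is closed (kernel_closed_poly).

    Let g be in this kernel.  Comparing the top coefficients of x y J(p, g),
    written with the Euler operators x d/dx and y d/dy, which only rescale
    monomials, shows that the exponents of the leading monomials of g and p are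
    proportional (mlead_jacobian0).  Hence the leading monomial of a kernel
    element is determined by its degree, so that the kernel elements of degree
    less than N form a space of dimension at most N (kernel_dependence).  There
    are quadratically many products p^i g^j below a given degree, all of them
    in the kernel, so they are eventually dependent: g is algebraic over K[p]
    (kernel_algebraic).  If a(p) is the leading coefficient of an algebraic
    equation of g, then a(p) g is integral over K[p], hence equal to some b(p)
    by closedness.  Dividing by the gcd of a and b and using a Bezout relation,
    the denominator becomes a unit of K[x,y], that is a constant, and g lies in
    K[p] (horner_alg_quotient). *)

(** * Integrality and derivatives of univariate polynomials *)

Section General.

(** With a the leading coefficient of q and n its degree, a^(n-1) q(u) is a
    monic polynomial expression of degree n in a u. *)
Lemma lead_coef_mul_integral (R : nzRingType) (S : comNzRingType)
    (phi : {rmorphism R -> S}) (q : {poly R}) (u : S) :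
  (1 < size q)%N -> root (map_poly phi q) u ->
  integralOver phi (phi (lead_coef q) * u).
Proof.
move=> size_q /rootP qu0; set a := lead_coef q.
have [n size_qE] : exists n, size q = n.+2.
  by exists (size q).-2; case: (size q) size_q => [|[|]].
pose r := 'X^(n.+1) + \poly_(i < n.+1) (q`_i * a ^+ (n - i)).
have r_monic : r \is monic.
  by rewrite monicE lead_coefDl ?lead_coefXn // size_polyXn ltnS size_poly.
exists r => //; apply/rootP.
rewrite rmorphD /= map_polyXn hornerD hornerXn.
have -> : (map_poly phi (\poly_(i < n.+1) (q`_i * a ^+ (n - i)))).[phi a * u]
    = phi a ^+ n * \sum_(i < n.+1) phi q`_i * u ^+ i.
  rewrite poly_def rmorph_sum horner_sum big_distrr /=; apply: eq_bigr => i _.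
  rewrite map_polyZ map_polyXn hornerZ hornerXn.
  rewrite rmorphM rmorphXn exprMn.
  have -> : phi a ^+ n = phi a ^+ (n - i) * phi a ^+ i.
    by rewrite -exprD subnK // -ltnS.
  ring.
rewrite exprMn exprSr -mulrA -mulrDr [X in _ * X]addrC.
rewrite (_ : _ + _ = 0) ?mulr0 // -[RHS]qu0.
rewrite (@horner_coef_wide _ n.+2); last first.
  by rewrite -size_qE size_poly.
rewrite [RHS]big_ord_recr /= coef_map /= /a lead_coefE size_qE.
by congr (_ + _); apply: eq_bigr => i _; rewrite coef_map.
Qed.

Lemma deriv_pchar0_neq0 (R : idomainType) (q : {poly R}) :
  [pchar R] =i pred0 -> (1 < size q)%N -> q^`() != 0.
Proof.
move=> /(pcharf0P R).1 charR; case size_q: (size q) => [|[|n]] // _.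
have : q`_n.+1 *+ n.+1 != 0.
  rewrite -mulr_natr mulf_neq0 ?charR // -[n.+1]/(n.+2.-1) -size_q.
  by rewrite -lead_coefE lead_coef_eq0 -size_poly_eq0 size_q.
by apply: contraNneq => q'0; rewrite -coef_deriv q'0 coef0.
Qed.

End General.

(** * Derivations of the polynomial ring in two variables *)

Section Derivations.
Variable K : fieldType.
Implicit Types (f g h p : {mpoly K[2]}) (T : W2 K).

Lemma W2_horner_alg T p (phi : {poly K}) :
  T (horner_alg p phi) = horner_alg p phi^`() * T p.
Proof.
elim/poly_ind: phi => [|phi c IH]; first by rewrite deriv0 !rmorph0 linear0 mul0r.
rewrite derivD derivM derivX derivC addr0 mulr1 !rmorphD !rmorphM /=.
rewrite horner_algC horner_algX linearD linearZ /= W2_1 scaler0 addr0.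
by rewrite W2_leibniz IH; ring.
Qed.

(** The derivation T acts on a Jacobian determinant by the Leibniz rule in each
    argument, except that it also differentiates the coordinates, which costs
    the factor div T; the second derivatives cancel by symmetry. *)
Lemma bracket_jacobian T f h :
  bracket T (jacobian_der f) h =
    jacobian_fun (T f) h - divergence T * jacobian_fun f h.
Proof.
rewrite /= /jacobian_fun /divergence !(W2E T f, W2E T h, W2E T (_ - _)).
rewrite !(mderivD, mderivN, mderivM).
rewrite !(mderiv_comm iy ix).
ring.
Qed.

Lemma jacobianC f g : jacobian_fun f g = - jacobian_der g f.
Proof. by rewrite /= /jacobian_fun; ring. Qed.

Lemma jacobian_horner p (phi : {poly K}) h :
  jacobian_fun (horner_alg p phi) h = horner_alg p phi^`() * jacobian_fun p h.
Proof. by rewrite !(jacobianC _ h) W2_horner_alg mulrN. Qed.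

(** * Leading monomials in the kernel of a Jacobian derivation *)

Lemma mdeg2 (m : 'X_{1..2}) : mdeg m = (m ix + m iy)%N.
Proof.
rewrite mdegE 2!big_ord_recl big_ord0 addn0 -/ix.
by rewrite (_ : lift _ _ = iy) //; apply: val_inj.
Qed.

(** The Euler operators are used in place of the partial derivatives because
    they are diagonal on monomials, which avoids any shift of exponents when
    leading coefficients are compared. *)
Lemma mcoeff_euler (i : 'I_2) g m : ('X_i * g^`M(i))@_m = g@_m *+ m i.
Proof.
elim/mpolyind: g => [|c k g _ _ IH].
  by rewrite mderiv0 mulr0 !mcoeff0 mul0rn.
rewrite mderivD mulrDr !mcoeffD IH mulrnDl; congr (_ + _).
rewrite mderivZ mderivX -!scalerAr !mcoeffZ mulrCA.
have [ki0|ki_gt0] := posnP (k i).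
  rewrite ki0 mul0r mcoeffX; case: eqP => [<-|_]; last by rewrite mulr0 mul0rn.
  by rewrite ki0 mulr0n.
rewrite -mpolyXD addmC submK ?lep1mP ?lt0n_neq0 // mcoeffX.
by case: eqP => [->|_]; rewrite ?mulr0 ?mul0rn // mulr_natl mulr1.
Qed.

Lemma mlead_euler_le (i : 'I_2) g : (mlead ('X_i * g^`M(i)) <= mlead g)%O.
Proof.
have [->|] := eqVneq ('X_i * g^`M(i)) 0; first by rewrite mlead0 le0x.
rewrite -mleadc_eq0 mcoeff_euler => nz; apply: msupp_le_mlead.
by rewrite mcoeff_msupp; apply: contraNneq nz => ->; rewrite mul0rn.
Qed.

Hypothesis charK : [pchar K] =i pred0.

Lemma natr_pchar0_inj : injective (fun n => n%:R : K).
Proof.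
suff le (m n : nat) : (m <= n)%N -> m%:R = n%:R :> K -> m = n.
  move=> m n eq_mn; case: (leqP m n) => [|/ltnW] /le; first exact.
  by move=> eq_nm; rewrite eq_nm.
move=> le_mn /esym/eqP; rewrite -subr_eq0 -natrB // (pcharf0P K).1 //; lia.
Qed.

(** The coefficient of x y J(g, p) at the product of the leading monomials is
    the product of the leading coefficients times the determinant of the two
    exponent vectors; in characteristic zero this determinant must vanish as an
    integer. *)
Lemma mlead_jacobian0 g p : g != 0 -> p != 0 -> jacobian_fun g p = 0 ->
  (mlead g ix * mlead p iy = mlead g iy * mlead p ix)%N.
Proof.
move=> nz_g nz_p J0; apply: natr_pchar0_inj; apply/eqP.
have : ('X_ix * g^`M(ix)) * ('X_iy * p^`M(iy))
       - ('X_iy * g^`M(iy)) * ('X_ix * p^`M(ix)) = 0.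
  by rewrite -[RHS](mulr0 ('X_ix * 'X_iy)) -J0 /jacobian_fun; ring.
move/(congr1 (mcoeff (mlead g + mlead p)%MM)).
rewrite mcoeffB mcoeff0 !mleadcMW ?mlead_euler_le // !mcoeff_euler.
have mulrnM (c d : K) a b : c *+ a * (d *+ b) = c * d * (a * b)%:R.
  by rewrite natrM -[c *+ a]mulr_natr -[d *+ b]mulr_natr mulrACA.
rewrite !mulrnM -mulrBr.
move/eqP; rewrite !mulf_eq0 !mleadc_eq0 (negPf nz_g) (negPf nz_p) /=.
by rewrite subr_eq0.
Qed.

(** Against h = x and h = y, the proportionality of leading exponents forces the
    leading monomial of p to be 1. *)
Lemma jacobian_fun_eq0 p : (forall h, jacobian_fun p h = 0) ->
  exists c, p = c%:MP.
Proof.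
move=> J0; have [->|nz_p] := eqVneq p 0; first by exists 0; rewrite mpolyC0.
have nzX i : 'X_i != 0 :> {mpoly K[2]}.
  by rewrite -msize_poly_eq0 msizeX.
have := mlead_jacobian0 nz_p (nzX ix) (J0 _).
have := mlead_jacobian0 nz_p (nzX iy) (J0 _).
rewrite !mleadXm !mnm1E /= !muln0 !muln1 => lead_x lead_y.
exists p@_0; apply: msize1_polyC.
by rewrite -mlead_deg // ltnS leqn0 mdeg2 lead_x -lead_y.
Qed.

Lemma jacobian_der_exp p g n :
  jacobian_der p g = 0 -> jacobian_der p (g ^+ n) = 0.
Proof.
move=> Jg; elim: n => [|n IH]; first by rewrite expr0 W2_1.
by rewrite exprS W2_leibniz Jg IH mul0r mulr0 addr0.
Qed.

Lemma jacobian_der_self p : jacobian_der p p = 0.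
Proof. by rewrite /= /jacobian_fun mulrC subrr. Qed.

(** * Elements of the kernel are algebraic over K[p] *)

Section Dependence.
Variable p : {mpoly K[2]}.
Hypothesis p_nonconst : (0 < mdeg (mlead p))%N.

Let nz_p : p != 0.
Proof. by apply: contraTneq p_nonconst => ->; rewrite mlead0 mdeg0. Qed.

(** The exponent vector of degree k proportional to that of the leading monomial
    of p.  The quotients are exact whenever such a vector exists. *)
Definition lead_ray k : 'X_{1..2} :=
  [multinom (k * mlead p i %/ mdeg (mlead p))%N | i < 2].

Lemma mlead_ray g : g != 0 -> jacobian_der p g = 0 ->
  mlead g = lead_ray (mdeg (mlead g)).
Proof.
move=> nz_g /(mlead_jacobian0 nz_p nz_g) E.
apply/mnmP => i; rewrite mnmE.
rewrite -[LHS](mulnK _ p_nonconst) !mdeg2.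
have [->|->] : i = ix \/ i = iy.
  by case: i => [[|[|//]]] lti; [left | right]; apply: val_inj.
all: congr (_ %/ _)%N; lia.
Qed.

(** By mlead_ray, an element of the kernel with degree less than N is zero as
    soon as its N coefficients at the monomials lead_ray k vanish. *)
Lemma kernel_dependence (I : finType) N (F : I -> {mpoly K[2]}) :
  (N < #|I|)%N -> (forall i, jacobian_der p (F i) = 0) ->
  (forall i, msize (F i) <= N)%N ->
  exists2 c : I -> K, (exists i, c i != 0) & \sum_i c i *: F i = 0.
Proof.
move=> ltN JF sizeF.
pose B := \matrix_(i < #|I|, k < N) (F (enum_val i))@_(lead_ray k).
have : kermx B != 0.
  rewrite kermx_eq0 -row_leq_rank -ltnNge.
  exact: leq_ltn_trans (rank_leq_col B) ltN.
case/rowV0Pn => v /sub_kermxP vB0 nz_v.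
have [j nz_vj] := rV0Pn _ nz_v.
pose c i := v 0 (enum_rank i).
exists c; first by exists (enum_val j); rewrite /c enum_valK.
set h := \sum_i _; apply/eqP; apply: contraTT isT => nz_h.
have Jh : jacobian_der p h = 0.
  rewrite linear_sum big1 // => i _.
  by rewrite linearZ /= -/(jacobian_der p (F i)) JF scaler0.
have hE m : h@_m = \sum_i c i * (F i)@_m.
  by rewrite raddf_sum; apply: eq_bigr => i _; rewrite /= mcoeffZ.
suff : mleadc h = 0 by move/eqP; rewrite mleadc_eq0 (negPf nz_h).
have [ltk|lek] := ltnP (mdeg (mlead h)) N; last first.
  rewrite hE big1 // => i _; rewrite memN_msupp_eq0 ?mulr0 //.
  exact/msize_mdeg_ge/(leq_trans (sizeF i)).
rewrite (mlead_ray nz_h Jh) hE.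
transitivity ((v *m B) 0 (Ordinal ltk)); last by rewrite vB0 mxE.
rewrite mxE.
rewrite [LHS](reindex_onto (fun i => enum_val i) enum_rank) /=; last first.
  by move=> i _; apply: enum_rankK.
rewrite (eq_bigl xpredT) => [|i]; last by rewrite enum_valK eqxx.
by apply: eq_bigr => i _; rewrite mxE /c enum_valK.
Qed.

(** A dependence between the products p^i g^j is a polynomial equation for g
    with coefficients in K[p]; it exists by counting. *)
Lemma kernel_algebraic g : jacobian_der p g = 0 ->
  exists2 q : {poly {poly K}}, q != 0 &
    root (map_poly (horner_alg p) q) g.
Proof.
move=> Jg; have [->|nz_g] := eqVneq g 0.
  by exists 'X; rewrite ?polyX_eq0 // map_polyX rootX.
set d := mdeg (mlead p); have d_gt0 : (0 < d)%N := p_nonconst.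
set e := mdeg (mlead g).
(* With i <= d e and j <= d there are (d e + 1) (d + 1) products, of degrees at
   most (d e) d + d e, and d > 0 makes the former exceed the number of these
   degrees. *)
pose I := ('I_(d * e).+1 * 'I_d.+1)%type.
pose F (ij : I) := p ^+ ij.1 * g ^+ ij.2.
have JF ij : jacobian_der p (F ij) = 0.
  rewrite W2_leibniz !jacobian_der_exp ?jacobian_der_self //.
  by rewrite mulr0 mul0r addr0.
have sizeF ij : (msize (F ij) <= (d * e * d + d * e).+1)%N.
  have nzX h k : h != 0 -> h ^+ k != 0 by move=> nz_h; rewrite expf_neq0.
  rewrite -mlead_deg ?mulf_neq0 ?nzX // mleadM ?nzX // !mleadX //.
  rewrite mdegD !mdegMn -/d -/e ltnS leq_add //.
    by rewrite mulnC leq_mul2r -ltnS ltn_ord orbT.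
  by rewrite mulnC leq_mul2r -ltnS ltn_ord orbT.
have [|c [[i0 j0] nz_c] rel] := kernel_dependence _ JF sizeF.
  rewrite card_prod !card_ord; nia.
pose q := \poly_(j < d.+1) \poly_(i < (d * e).+1) c (inord i, inord j).
have qE : (map_poly (horner_alg p) q).[g] = 0.
  rewrite -[RHS]rel /q poly_def rmorph_sum horner_sum /=.
  have -> : \sum_ij c ij *: F ij = \sum_j \sum_i c (i, j) *: F (i, j).
    by rewrite exchange_big pair_bigA /=; apply: eq_bigr => -[].
  apply: eq_bigr => j _; rewrite map_polyZ map_polyXn hornerZ hornerXn.
  rewrite poly_def rmorph_sum mulr_suml /=; apply: eq_bigr => i _.
  by rewrite linearZ rmorphXn /= horner_algX !inord_val /F /= -mulrA mulr_algl.
exists q; last exact/rootP.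
apply: contraNneq nz_c => q0.
have := congr1 (fun r : {poly {poly K}} => r`_j0`_i0) q0.
by rewrite !coef0 !(coef_poly, ltn_ord, inord_val) => ->.
Qed.
End Dependence.
End Derivations.

(** * The kernel of a closed polynomial *)

Section ClosedField.
Variable K : closedFieldType.
Implicit Types (f g h p : {mpoly K[2]}) (T : W2 K).

(** A nonzero phi is a product of linear factors, and no p - z vanishes: a
    nonconstant p is transcendental over K. *)
Lemma horner_alg_eq0 p (phi : {poly K}) :
  (forall c, p <> c%:MP) -> (horner_alg p phi == 0) = (phi == 0).
Proof.
move=> p_nonconst; apply/idP/idP => [|/eqP->]; last by rewrite rmorph0.
apply: contraLR => nz_phi; have [r ->] := closed_field_poly_normal phi.
rewrite linearZ /= mulf_eq0 alg_mpolyC mpolyC_eq0 lead_coef_eq0 (negPf nz_phi) /=.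
rewrite rmorph_prod.
rewrite prodf_seq_neq0; apply/allP => z _ /=; apply: contra_notN (p_nonconst z).
by rewrite rmorphB /= horner_algX horner_algC alg_mpolyC subr_eq0 => /eqP.
Qed.

(** A root z of phi would make p - z a divisor of a unit of K[x,y], hence a
    constant. *)
Lemma horner_alg_unit p (phi : {poly K}) :
  (forall c, p <> c%:MP) -> horner_alg p phi \is a GRing.unit ->
  exists2 c, c != 0 & phi = c%:P.
Proof.
move=> p_nonconst phi_unit; apply/size_poly1P.
apply: contraT => /closed_rootP[r].
case/factor_theorem => psi phiE; move: phi_unit.
rewrite phiE rmorphM unitrM => /andP[_ /andP[/eqP]].
rewrite rmorphB /= horner_algX horner_algC alg_mpolyC => /(canRL (subrK _)).
by rewrite -mpolyCD => /p_nonconst.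
Qed.

(** After division by gcd(a, b), a Bezout relation u a + v b = 1 evaluated at p
    reads a(p) (u(p) + v(p) g) = 1, so that a(p) is invertible. *)
Lemma horner_alg_quotient p g (a b : {poly K}) :
  (forall c, p <> c%:MP) -> a != 0 -> horner_alg p a * g = horner_alg p b ->
  exists phi, g = horner_alg p phi.
Proof.
move=> p_nonconst nz_a ag; set d := gcdp a b.
have nz_d : d != 0 by rewrite gcdp_eq0 negb_and nz_a.
have aE : a = d * (a %/ d) by rewrite divpKC ?dvdp_gcdl.
have bE : b = d * (b %/ d) by rewrite divpKC ?dvdp_gcdr.
have {}ag : horner_alg p (a %/ d) * g = horner_alg p (b %/ d).
  apply: (@mulfI _ (horner_alg p d)); first by rewrite horner_alg_eq0.
  by rewrite mulrA -!rmorphM -aE -bE.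
have /Bezout_eq1_coprimepP[[u v] /= uv1] : coprimep (a %/ d) (b %/ d).
  by rewrite coprimep_div_gcd // nz_a.
have a_unit : horner_alg p (a %/ d) \is a GRing.unit.
  apply/unitrPr; exists (horner_alg p u + horner_alg p v * g).
  rewrite -(rmorph1 (horner_alg p)) -uv1 rmorphD !rmorphM /= -ag; ring.
have [c nz_c cE] := horner_alg_unit p_nonconst a_unit.
exists (c^-1 *: (b %/ d)); rewrite linearZ /= alg_mpolyC -ag cE horner_algC.
by rewrite alg_mpolyC mulrA -mpolyCM mulVf // mpolyC1 mul1r.
Qed.

Hypothesis charK : [pchar K] =i pred0.

(** This is where closedness of p enters: it turns the integral element a(p) g
    into an element of K[p]. *)
Lemma kernel_closed_poly p g : closed_poly p -> jacobian_der p g = 0 ->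
  exists phi, g = horner_alg p phi.
Proof.
case=> p_nonconst p_closed Jg.
have lead_p : (0 < mdeg (mlead p))%N.
  rewrite lt0n; apply/negP => /eqP deg0; apply: (p_nonconst p@_0).
  apply: msize1_polyC; have [->|nz_p] := eqVneq p 0; first by rewrite msize0.
  by rewrite -mlead_deg // deg0.
have [q nz_q qg] := kernel_algebraic charK lead_p Jg.
have size_q : (1 < size q)%N.
  rewrite ltnNge; apply/negP => /size1_polyC qC; move: qg nz_q.
  rewrite qC map_polyC rootC /= horner_alg_eq0 // polyC_eq0.
  by move=> ->.
have [phi phiE] := p_closed _ (lead_coef_mul_integral size_q qg).
by apply: horner_alg_quotient phiE; rewrite // lead_coef_eq0.
Qed.

End ClosedField.

Theorem theorem1 (K : closedFieldType) (charK : [pchar K] =i pred0)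
    (f p : {mpoly K[2]}) (hp : generative_closed f p)
    (theta : {poly K}) (htheta : (1 < size theta)%N)
    (hf : f = horner_alg p theta) (T : W2 K) :
  bracket T (jacobian_der f) =1 (fun=> 0) <->
  exists psi : {poly K},
    T p = horner_alg p psi /\
    horner_alg p theta^`()^`() * horner_alg p psi =
      horner_alg p theta^`() * (divergence T - horner_alg p psi^`()).
Proof.
have [p_closed _] := hp; have [p_nonconst _] := p_closed.
(* The bracket is D_p times the difference of the two sides of the differential
   equation, so both implications can be read off this formula. *)
have bracketE psi h : T p = horner_alg p psi ->
  bracket T (jacobian_der f) h =
    (horner_alg p theta^`()^`() * horner_alg p psi -
     horner_alg p theta^`() * (divergence T - horner_alg p psi^`()))
    * jacobian_fun p h.
  move=> Tp; rewrite bracket_jacobian hf W2_horner_alg Tp -rmorphM.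
  by rewrite !jacobian_horner derivM rmorphD !rmorphM /=; ring.
split=> [comm|[psi [Tp eq_psi]] h]; last first.
  by rewrite (bracketE psi) // eq_psi subrr mul0r.
have nz_theta' : horner_alg p theta^`() != 0.
  by rewrite horner_alg_eq0 // deriv_pchar0_neq0.
have Jp0 : jacobian_der p (T p) = 0.
  have JfE h : jacobian_der f h = horner_alg p theta^`() * jacobian_der p h.
    by rewrite hf; apply: jacobian_horner.
  have := comm f; rewrite bracket_jacobian.
  rewrite [jacobian_fun f f](jacobian_der_self f) mulr0 subr0 jacobianC.
  rewrite [in T f]hf W2_horner_alg W2_leibniz !JfE W2_horner_alg.
  rewrite jacobian_der_self !mulr0 mul0r add0r => /eqP.
  by rewrite oppr_eq0 !mulf_eq0 (negPf nz_theta') /= => /eqP.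
have [psi Tp] := kernel_closed_poly charK p_closed Jp0.
exists psi; split=> //; apply/eqP; rewrite -subr_eq0; apply/negPn/negP => nz_e.
have [|c] := jacobian_fun_eq0 charK (p := p); last exact: p_nonconst.
move=> h; apply: (mulfI nz_e); rewrite mulr0 -bracketE //; exact: comm.
Qed.
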